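(* Let $(\mathfrak g,B)$ be a non-zero complex quadratic Lie algebra which admits a symplectic structure, with $\dim\mathfrak g\le 8$. Then $(\mathfrak g,B)$ is isometrically isomorphic to the trivial $T^*$-extension $T^*_0\mathfrak a$ of one of the following Lie algebras $\mathfrak a$: the abelian Lie algebras $\mathbb C$, $\mathbb C^2$, $\mathbb C^3$, $\mathbb C^4$, the Heisenberg algebra $\mathcal L_2$, the direct sum $\mathcal L_2\oplus\mathbb C$, or the filiform Lie algebra $\mathcal L_3$.
   Context: A quadratic Lie algebra $(\mathfrak g,B)$ is a Lie algebra $\mathfrak g$ with a non-degenerate symmetric bilinear form $B$ such that $B([x,y],z)=B(x,[y,z])$ for all $x,y,z$. A symplectic structure on a Lie algebra $\mathfrak g$ is a non-degenerate skew-symmetric bilinear form $\omega$ with $\omega([x,y],z)+\omega([y,z],x)+\omega([z,x],y)=0$ for all $x,y,z\in\mathfrak g$ (no compatibility with $B$ is required). Two quadratic Lie algebras are isometrically isomorphic if there is a Lie algebra isomorphism between them preserving the bilinear forms. The trivial $T^*$-extension $T^*_0\mathfrak a$ of a Lie algebra $\mathfrak a$ is the vector space $\mathfrak a\oplus\mathfrak a^*$ with bracket $[x+f,y+g]=[x,y]_{\mathfrak a}+f\circ\mathrm{ad}_{\mathfrak a}(y)-g\circ\mathrm{ad}_{\mathfrak a}(x)$ and invariant form $B(x+f,y+g)=f(y)+g(x)$, for $x,y\in\mathfrak a$, $f,g\in\mathfrak a^*$. $\mathcal L_2$ is the complex Lie algebra with basis $x_1,x_2,x_3$ whose only non-trivial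 bracket is $[x_1,x_2]=x_3$; $\mathcal L_3$ is the complex Lie algebra with basis $x_1,x_2,x_3,x_4$ whose only non-trivial brackets are $[x_1,x_2]=x_3$ and $[x_1,x_3]=x_4$. $\mathcal L_2\oplus\mathbb C$ is the direct sum of Lie algebras with $\mathbb C$ abelian. *)

(* Defs.v *)
From HB Require Import structures.
From mathcomp Require Import all_boot all_order all_algebra.
From mathcomp Require Import ring.

Set Implicit Arguments.
Unset Strict Implicit.
Unset Printing Implicit Defensive.

Import GRing.Theory.
Local Open Scope ring_scope.

HB.mixin Record Vector_isLie (K : fieldType) (g : Type) of Vector K g := {
  lie : g -> g -> g;
  lie_is_linearl : forall y, linear (lie^~ y);
  lie_is_linearr : forall x, linear (lie x);
  lie_alternating : forall x, lie x x = 0;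
  lie_jacobi : forall x y z,
    lie x (lie y z) + lie y (lie z x) + lie z (lie x y) = 0
}.

#[short(type="lieAlgType")]
HB.structure Definition LieAlg (K : fieldType) :=
  { g of Vector K g & Vector_isLie K g }.

Section LieTheory.
Variables (K : fieldType) (g : lieAlgType K).
Implicit Types x y z : g.

HB.instance Definition _ := bilinear_isBilinear.Build K g g g _ _ (@lie K g)
  (@lie_is_linearl K g, @lie_is_linearr K g).

HB.instance Definition _ x :=
  GRing.isLinear.Build K g g _ (lie x) (@lie_is_linearr K g x).

Definition ad x : 'End(g) := linfun (lie x).

Lemma adE x y : ad x y = lie x y.
Proof. by rewrite lfunE. Qed.

Lemma lieC x y : lie x y = - lie y x.
Proof.
apply/eqP; rewrite -addr_eq0; apply/eqP.
have := lie_alternating (x + y).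
by rewrite linearDl !linearDr /= !lie_alternating add0r addr0.
Qed.

Definition quadratic (B : {symmetric g}) : Prop :=
  nondegenerate B /\ forall x y z, B (lie x y) z = B x (lie y z).

Definition symplectic (w : {skew_symmetric g}) : Prop :=
  nondegenerate w /\
  forall x y z, w (lie x y) z + w (lie y z) x + w (lie z x) y = 0.

End LieTheory.

Definition isometrically_isomorphic (K : fieldType) (g h : lieAlgType K)
    (B : {symmetric g}) (B' : {symmetric h}) : Prop :=
  exists f : 'Hom(g, h), [/\ bijective f,
    {morph f : x y / lie x y} &
    isometry B' B f].

(* The trivial T^*-extension T^*_0 a; the dual of a is 'Hom(a, K^o), and the
   element x + f is the pair (x, f). *)
Definition Tstar (K : fieldType) (a : lieAlgType K) : Type :=
  (a * 'Hom(a, K^o))%type.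

Section Tstar.
Variables (K : fieldType) (a : lieAlgType K).
HB.instance Definition _ := Vector.copy (Tstar a) (a * 'Hom(a, K^o))%type.
Implicit Types u v w : Tstar a.

Definition Tstar_lie u v : Tstar a :=
  (lie u.1 v.1, (u.2 \o ad v.1)%VF - (v.2 \o ad u.1)%VF).

Definition Tstar_form u v : K := u.2 v.1 + v.2 u.1.

Let TstarE := (adE, comp_lfunE, add_lfunE, opp_lfunE, scale_lfunE).

Fact Tstar_lie_alternating u : Tstar_lie u u = 0.
Proof. by rewrite /Tstar_lie lie_alternating subrr. Qed.

Fact Tstar_lie_linearr u : linear (Tstar_lie u).
Proof.
move=> c v w; congr (_, _) => /=; first by rewrite linearPr.
apply/lfunP=> x; rewrite !TstarE linearPl linearP.
by rewrite scalerBr opprD addrACA.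
Qed.

Fact Tstar_lie_linearl v : linear (Tstar_lie^~ v).
Proof.
move=> c u w; congr (_, _) => /=; first by rewrite linearPl.
apply/lfunP=> x; rewrite !TstarE linearPl linearP.
by rewrite scalerBr opprD addrACA.
Qed.

Fact Tstar_lie_jacobi u v w :
  Tstar_lie u (Tstar_lie v w) + Tstar_lie v (Tstar_lie w u)
    + Tstar_lie w (Tstar_lie u v) = 0.
Proof.
congr (_, _) => /=; first exact: lie_jacobi.
apply/lfunP=> x; rewrite !TstarE zero_lfunE.
have J (f : 'Hom(a, K^o)) y z :
    f (lie (lie y z) x) = f (lie y (lie z x)) - f (lie z (lie y x)).
  rewrite -raddfB; congr (f _).
  have /eqP := lie_jacobi y z x.
  rewrite addrC addr_eq0 (lieC x) eqr_oppLR => /eqP ->.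
  by rewrite opprK (lieC x y) linearNr.
by rewrite !J; ring.
Qed.

HB.instance Definition _ := Vector_isLie.Build K (Tstar a)
  Tstar_lie_linearl Tstar_lie_linearr Tstar_lie_alternating Tstar_lie_jacobi.

Fact Tstar_form_bilinear :
  bilinear_for (GRing.Scale.Law.clone _ _ *%R _)
    (GRing.Scale.Law.clone _ _ (idfun \; *%R) _) Tstar_form.
Proof.
by split=> [v|u] c x y; rewrite /Tstar_form /= !TstarE linearP mulrDr addrACA.
Qed.

HB.instance Definition _ :=
  bilinear_isBilinear.Build K _ _ _ _ _ Tstar_form Tstar_form_bilinear.

Fact Tstar_form_sym u v : Tstar_form u v = (-1) ^+ false * idfun (Tstar_form v u).
Proof. by rewrite mul1r /Tstar_form addrC. Qed.

HB.instance Definition _ :=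
  isHermitianSesquilinear.Build K _ false idfun Tstar_form Tstar_form_sym.

Lemma Tstar_quadratic : quadratic Tstar_form.
Proof.
split=> [|u v w]; last first.
  change (Tstar_form (Tstar_lie u v) w = Tstar_form u (Tstar_lie v w)).
  rewrite /Tstar_form /= !TstarE (lieC w.1) (lieC v.1 u.1).
  by rewrite !linearN /= opprK addrA.
rewrite /nondegenerate -subv0; apply/subvP=> u /mem_orthovP u_rad.
rewrite memv0; apply/eqP; case: u u_rad => x f u_rad.
have {}u_rad y (g : 'Hom(a, K^o)) : f y + g x = 0.
  exact: (u_rad (y, g) (memvf _)).
congr (_, _).
  rewrite (coord_vbasis (memvf x)); apply: big1 => i _.
  have := u_rad 0 (linfun (coord (vbasis fullv) i : a -> K^o)).
  by rewrite linear0 add0r lfunE /= => ->; rewrite scale0r.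
by apply/lfunP=> y; have := u_rad y 0; rewrite !zero_lfunE addr0.
Qed.

End Tstar.

Arguments Tstar_form {K} a.

(* In K^n, the row vectors 'e_0, 'e_1, ... stand for x_1, x_2, ...;
   heisenberg is L_2 and filiform is L_3. *)
Definition abelian_lie (K : fieldType) (n : nat) : Type := 'rV[K]_n.

Section Abelian.
Variables (K : fieldType) (n : nat).
HB.instance Definition _ := Vector.copy (abelian_lie K n) 'rV[K]_n.
Let lie0 (x y : abelian_lie K n) : abelian_lie K n := 0.

Let lie0_linear x : linear (lie0 x).
Proof. by move=> c y z; rewrite scaler0 addr0. Qed.

Let lie0_jacobi x y z :
  lie0 x (lie0 y z) + lie0 y (lie0 z x) + lie0 z (lie0 x y) = 0.
Proof. by rewrite !addr0. Qed.

HB.instance Definition _ := Vector_isLie.Build K (abelian_lie K n)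
  lie0_linear lie0_linear (fun=> erefl) lie0_jacobi.
End Abelian.

Definition heisenberg (K : fieldType) : Type := 'rV[K]_3.

Section Heisenberg.
Variable K : fieldType.
HB.instance Definition _ := Vector.copy (heisenberg K) 'rV[K]_3.
Implicit Types x y z : heisenberg K.

Definition heisenberg_lie x y : heisenberg K :=
  (x 0 0 * y 0 1 - x 0 1 * y 0 0) *: 'e_2.

Fact heisenberg_linearr x : linear (heisenberg_lie x).
Proof. by move=> c y z; apply/rowP=> i; rewrite !mxE; ring. Qed.

Fact heisenberg_linearl y : linear (heisenberg_lie^~ y).
Proof. by move=> c x z; apply/rowP=> i; rewrite !mxE; ring. Qed.

Fact heisenberg_alternating x : heisenberg_lie x x = 0.
Proof. by rewrite /heisenberg_lie mulrC subrr scale0r. Qed.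

Fact heisenberg_jacobi x y z :
  heisenberg_lie x (heisenberg_lie y z) + heisenberg_lie y (heisenberg_lie z x)
    + heisenberg_lie z (heisenberg_lie x y) = 0.
Proof. by apply/rowP=> i; rewrite !mxE /=; ring. Qed.

HB.instance Definition _ := Vector_isLie.Build K (heisenberg K)
  heisenberg_linearl heisenberg_linearr
  heisenberg_alternating heisenberg_jacobi.

Lemma heisenberg_basis (e := fun i => 'e_i : heisenberg K) :
  [/\ lie (e 0) (e 1) = e 2, lie (e 0) (e 2) = 0 & lie (e 1) (e 2) = 0].
Proof.
by split; apply/rowP=> i; rewrite !mxE /= ?(mul0r, mulr0, mul1r, subr0).
Qed.
End Heisenberg.

Definition filiform (K : fieldType) : Type := 'rV[K]_4.

Section Filiform.
Variable K : fieldType.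
HB.instance Definition _ := Vector.copy (filiform K) 'rV[K]_4.
Implicit Types x y z : filiform K.

Definition filiform_lie x y : filiform K :=
  (x 0 0 * y 0 1 - x 0 1 * y 0 0) *: 'e_2
    + (x 0 0 * y 0 2 - x 0 2 * y 0 0) *: 'e_3.

Fact filiform_linearr x : linear (filiform_lie x).
Proof. by move=> c y z; apply/rowP=> i; rewrite !mxE; ring. Qed.

Fact filiform_linearl y : linear (filiform_lie^~ y).
Proof. by move=> c x z; apply/rowP=> i; rewrite !mxE; ring. Qed.

Fact filiform_alternating x : filiform_lie x x = 0.
Proof. by apply/rowP=> i; rewrite !mxE; ring. Qed.

Fact filiform_jacobi x y z :
  filiform_lie x (filiform_lie y z) + filiform_lie y (filiform_lie z x)
    + filiform_lie z (filiform_lie x y) = 0.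
Proof. by apply/rowP=> i; rewrite !mxE /=; ring. Qed.

HB.instance Definition _ := Vector_isLie.Build K (filiform K)
  filiform_linearl filiform_linearr filiform_alternating filiform_jacobi.

Lemma filiform_basis (e := fun i => 'e_i : filiform K) :
  [/\ lie (e 0) (e 1) = e 2, lie (e 0) (e 2) = e 3, lie (e 0) (e 3) = 0 &
      [/\ lie (e 1) (e 2) = 0, lie (e 1) (e 3) = 0 & lie (e 2) (e 3) = 0]].
Proof.
by split; last split; apply/rowP=> i;
  rewrite !mxE /=; ring.
Qed.
End Filiform.

Section DirectSum.
Variables (K : fieldType) (g h : lieAlgType K).
Implicit Types u v w : (g * h)%type.

Let lie_pair u v : (g * h)%type := (lie u.1 v.1, lie u.2 v.2).

Let lie_pair_linearr u : linear (lie_pair u).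
Proof. by move=> c v w; rewrite /lie_pair /= !linearPr. Qed.

Let lie_pair_linearl v : linear (lie_pair^~ v).
Proof. by move=> c u w; rewrite /lie_pair /= !linearPl. Qed.

Let lie_pair_alternating u : lie_pair u u = 0.
Proof. by rewrite /lie_pair !lie_alternating. Qed.

Let lie_pair_jacobi u v w :
  lie_pair u (lie_pair v w) + lie_pair v (lie_pair w u)
    + lie_pair w (lie_pair u v) = 0.
Proof. by congr (_, _); apply: lie_jacobi. Qed.

HB.instance Definition _ := Vector_isLie.Build K (g * h)%type
  lie_pair_linearl lie_pair_linearr lie_pair_alternating lie_pair_jacobi.
End DirectSum.

(* Main.v *)
Require Import Defs.
From HB Require Import structures.
From mathcomp Require Import all_boot all_order all_algebra.
From mathcomp Require Import reals complex.
From mathcomp Require Import ring.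

Set Implicit Arguments.
Unset Strict Implicit.
Unset Printing Implicit Defensive.

Import Order.TTheory GRing.Theory Num.Theory.
Local Open Scope ring_scope.

(** Since B is non-degenerate, the symplectic form is w(x, y) = B(D x, y) for a
    unique endomorphism D. Skew-symmetry of w makes D skew for B, closedness
    of w makes D a derivation, and non-degeneracy of w makes D injective
    ([exists_skew_derivation]). The Lie algebra is therefore graded by the
    generalized eigenspaces g_a of D, all with a <> 0: B pairs g_a with g_(-a)
    only ([form_weight0]), and the alternating 3-form I(x, y, z) = B([x, y], z)
    vanishes on g_a x g_b x g_c unless a + b + c = 0 ([triple_weight0]).

    Order the complex numbers lexicographically by real and imaginary parts.
    The positive and the negative weights cut g into two isotropic subalgebras
    in duality. A basis e_0, ..., e_(n-1) of the positive half made of weight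
    vectors, sorted by weight, and its dual basis f_0, ..., f_(n-1) of the
    negative half, describe I completely by the constants
    c_ijk = I(e_i, e_j, f_k) and d_ijk = I(f_i, f_j, e_k). If one of them is
    not zero, the weights satisfy a_i + a_j = a_k with all three positive, so
    that i, j < k ([exists_bialgebra_frame]).

    When dim g = 2n <= 8 few constants survive: none for n <= 2, one c and one
    d for n = 3, and for n = 4 four of each, those with ij -> k among 01 -> 2,
    01 -> 3, 02 -> 3 and 12 -> 3. The Jacobi identity makes sums of products of
    a c by a d vanish ([structure_const_cocycle]). It follows that, up to
    exchanging e and f, the constant d_012 is the only d that can be non-zero,
    and that c_012 = c_013 = 0 if it is ([frame3_classified],
    [frame4_classified]). The remaining 3-forms are brought by changes of
    hyperbolic basis to
    I = s v_0 /\ v_1 /\ u_2 + t v_0 /\ v_2 /\ u_3 ([classified_top]), and after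
    rescaling these are the 3-forms of the T^*-extensions of C^4, of L_2 + C
    and of L_3 ([classified_chain]). *)

(** * Bilinear forms and brackets *)

Section Forms.
Variables (K : fieldType) (eps : bool) (V : vectType K).
Variable B : {hermitian V for eps & idfun}.
Implicit Types x y z : V.

Lemma hermDl x y z : B (x + y) z = B x z + B y z. Proof. exact: linearDl. Qed.
Lemma hermDr x y z : B x (y + z) = B x y + B x z. Proof. exact: linearDr. Qed.
Lemma hermNl x z : B (- x) z = - B x z. Proof. exact: linearNl. Qed.
Lemma hermNr x z : B x (- z) = - B x z. Proof. exact: linearNr. Qed.
Lemma hermBl x y z : B (x - y) z = B x z - B y z. Proof. exact: linearBl. Qed.
Lemma hermBr x y z : B x (y - z) = B x y - B x z. Proof. exact: linearBr. Qed.
Lemma hermZl c x z : B (c *: x) z = c * B x z. Proof. exact: linearZl_LR. Qed.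
Lemma hermZr c x z : B x (c *: z) = c * B x z. Proof. exact: linearZr_LR. Qed.
Lemma herm0l z : B 0 z = 0. Proof. exact: linear0l. Qed.
Lemma herm0r z : B z 0 = 0. Proof. exact: linear0r. Qed.
Lemma herm_suml I (r : seq I) (P : pred I) (F : I -> V) z :
  B (\sum_(i <- r | P i) F i) z = \sum_(i <- r | P i) B (F i) z.
Proof. exact: linear_sumlz. Qed.
Lemma herm_sumr I (r : seq I) (P : pred I) (F : I -> V) z :
  B z (\sum_(i <- r | P i) F i) = \sum_(i <- r | P i) B z (F i).
Proof. exact: linear_sumr. Qed.

Lemma nondegenerateP :
  nondegenerate B <-> forall x, (forall y, B x y = 0) -> x = 0.
Proof.
rewrite /nondegenerate; split=> [/eqP B_nd x Bx0 | B_nd].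
  apply/eqP; rewrite -memv0 -B_nd; apply/mem_orthovP=> y _; exact: Bx0.
rewrite -subv0; apply/subvP=> x /mem_orthovP Bx0; rewrite memv0; apply/eqP.
by apply: B_nd => y; apply: Bx0; apply: memvf.
Qed.

Lemma herm_ext : nondegenerate B ->
  forall x y, (forall z, B x z = B y z) -> x = y.
Proof.
move=> /nondegenerateP B_nd x y Bxy; apply/eqP; rewrite -subr_eq0; apply/eqP.
by apply: B_nd => z; rewrite hermBl Bxy subrr.
Qed.
End Forms.

Lemma symC (K : fieldType) (V : vectType K) (B : {symmetric V}) x y :
  B x y = B y x.
Proof. by rewrite hermC expr0 mul1r. Qed.

Lemma skewC (K : fieldType) (V : vectType K) (w : {skew_symmetric V}) x y :
  w x y = - w y x.
Proof. by rewrite hermC expr1 mulN1r. Qed.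

Section Lie.
Variables (K : fieldType) (g : lieAlgType K).
Implicit Types x y z : g.

Lemma lieDl x y z : lie (x + y) z = lie x z + lie y z.
Proof. exact: linearDl. Qed.
Lemma lieDr x y z : lie x (y + z) = lie x y + lie x z.
Proof. exact: linearDr. Qed.
Lemma lieBl x y z : lie (x - y) z = lie x z - lie y z.
Proof. exact: linearBl. Qed.
Lemma lieBr x y z : lie x (y - z) = lie x y - lie x z.
Proof. exact: linearBr. Qed.
Lemma lieZl c x z : lie (c *: x) z = c *: lie x z.
Proof. exact: linearZl_LR. Qed.
Lemma lieZr c x z : lie x (c *: z) = c *: lie x z.
Proof. exact: linearZr_LR. Qed.
Lemma lie_suml I (r : seq I) (P : pred I) (F : I -> g) z :
  lie (\sum_(i <- r | P i) F i) z = \sum_(i <- r | P i) lie (F i) z.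
Proof. exact: linear_sumlz. Qed.
Lemma lie_sumr I (r : seq I) (P : pred I) (F : I -> g) z :
  lie z (\sum_(i <- r | P i) F i) = \sum_(i <- r | P i) lie z (F i).
Proof. exact: linear_sumr. Qed.
End Lie.

Lemma inj_lfun_bij (K : fieldType) (U V : vectType K) (f : 'Hom(U, V)) :
  \dim {:U} = \dim {:V} -> injective f -> bijective f.
Proof.
move=> dimUV /lker0P kf; have fim : limg f = fullv.
  by apply/eqP; rewrite eqEdim subvf limg_dim_eq ?(eqP kf) ?capv0 ?dimUV /=.
exists (f^-1)%VF; first exact: lker0_lfunK.
by move=> y; rewrite limg_lfunVK // fim memvf.
Qed.

Lemma dim_dual (K : fieldType) (a : vectType K) :
  \dim {: 'Hom(a, K^o)} = \dim {:a}.
Proof. by rewrite !dimvf /dim /= muln1. Qed.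

(** * Recognizing a trivial T^*-extension *)

Section Iso.
Variables (K : fieldType) (g : lieAlgType K) (B : {symmetric g}).
Hypothesis B_quad : quadratic B.

(** When B is non-degenerate and dim g = 2n, this single identity says that the
    families [u] and [v] are isotropic, dual to each other, and together a
    basis of g. *)
Definition hyperbolic n (u v : 'I_n -> g) := forall x y,
  B x y = \sum_i (B x (u i) * B y (v i) + B x (v i) * B y (u i)).

(** The isometry sends x to the pair of sum_i B(x, v_i) X_i and
    sum_i B(x, u_i) xi_i. It preserves the forms because (u, v) is hyperbolic;
    in a quadratic Lie algebra a bracket is determined by the values of
    B([x, y], z), so that it is enough to compare these, and in the
    T^*-extension they are the cyclic sum on the right. Quantifying over
    p, q, r with prescribed coordinates stands for the projections of x, y, z
    to [a]. *)
Lemma isometric_Tstar (a : lieAlgType K) n (u v : 'I_n -> g) (X : 'I_n -> a)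
    (xi : 'I_n -> 'Hom(a, K^o)) :
  hyperbolic u v -> \dim {:g} = n.*2 -> \dim {:a} = n ->
  (forall i j, xi i (X j) = (i == j)%:R) ->
  (forall x y z p q r,
     (forall i, xi i p = B x (v i)) -> (forall i, xi i q = B y (v i)) ->
     (forall i, xi i r = B z (v i)) ->
   B (lie x y) z = \sum_k B z (u k) * xi k (lie p q)
     + \sum_k B x (u k) * xi k (lie q r) + \sum_k B y (u k) * xi k (lie r p)) ->
  isometrically_isomorphic B (Tstar_form a).
Proof.
case: B_quad => B_nd B_inv uv_c dim_g dim_a xiX B_tau.
pose proj x := \sum_i B x (v i) *: X i.
pose rho x : 'Hom(a, K^o) := \sum_i B x (u i) *: xi i.
pose phi x : Tstar a := (proj x, rho x).
have phi_lin : linear phi.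
  move=> c x y; congr (_, _).
    rewrite /= /proj scaler_sumr -big_split; apply: eq_bigr => i _ /=.
    by rewrite hermDl hermZl scalerDl scalerA.
  rewrite /= /rho scaler_sumr -big_split; apply: eq_bigr => i _ /=.
  by rewrite hermDl hermZl scalerDl scalerA.
have rhoE x y : rho x y = \sum_i B x (u i) * xi i y.
  by rewrite sum_lfunE; apply: eq_bigr => i _; rewrite scale_lfunE.
have xi_proj i y : xi i (proj y) = B y (v i).
  rewrite /proj linear_sum (bigD1 i) //= big1 => [|j ji].
    by rewrite linearZ /= xiX eqxx addr0 [LHS]mulr1.
  by rewrite linearZ /= xiX eq_sym (negPf ji) scaler0.
have rho_proj x y : rho x (proj y) = \sum_i B x (u i) * B y (v i).
  by rewrite rhoE; apply: eq_bigr => i _; rewrite xi_proj.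
pose philin := GRing.isLinear.Build K g (Tstar a) _ phi phi_lin.
pose phi' : {linear g -> Tstar a} := HB.pack phi philin.
pose f : 'Hom(g, Tstar a) := linfun phi'.
have fE x : f x = phi x by rewrite lfunE.
have f_iso : isometry (Tstar_form a) B f.
  move=> x y; rewrite !fE.
  change (rho x (proj y) + rho y (proj x) = B x y).
  rewrite !rho_proj uv_c big_split /=.
  by congr (_ + _); apply: eq_bigr => i _; rewrite mulrC.
have f_inj : injective f.
  move=> x y fxy; apply: (herm_ext B_nd) => z.
  by rewrite -!f_iso fxy.
have f_bij : bijective f.
  apply: inj_lfun_bij => //.
  by rewrite dim_g [RHS]dimvf -addnn -{1}dim_a -dim_a -{2}dim_dual !dimvf.
exists f; split=> // x y.
have [f' fK f'K] := f_bij.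
apply: (herm_ext (proj1 (Tstar_quadratic a))) => z'.
rewrite -[z']f'K; move: {z'} (f' z') => z.
rewrite f_iso (B_tau x y z _ _ _ (xi_proj^~ x) (xi_proj^~ y) (xi_proj^~ z)) !fE.
rewrite -!rhoE; change (rho z (lie (proj x) (proj y))
    + rho x (lie (proj y) (proj z)) + rho y (lie (proj z) (proj x)) =
  ((rho x \o ad (proj y))%VF - (rho y \o ad (proj x))%VF) (proj z)
    + rho z (lie (proj x) (proj y))).
rewrite add_lfunE opp_lfunE !comp_lfunE !adE (lieC (proj z)) linearN /=.
by rewrite -addrA addrC.
Qed.
End Iso.

Definition functional (K : fieldType) (a : vectType K) (phi : a -> K^o)
    (phi_lin : linear phi) : 'Hom(a, K^o) :=
  linfun (HB.pack phi (GRing.isLinear.Build K a K^o _ phi phi_lin)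
            : {linear a -> K^o}).

Lemma functionalE (K : fieldType) (a : vectType K) (phi : a -> K^o)
  (phi_lin : linear phi) x : functional phi_lin x = phi x.
Proof. by rewrite lfunE. Qed.

Lemma entry_linear (K : fieldType) n (i : 'I_n) :
  linear (fun x : 'rV[K]_n => x 0 i : K^o).
Proof. by move=> c x y; rewrite !mxE. Qed.

Lemma sum_ord3 (V : nmodType) (F : 'I_3 -> V) :
  \sum_i F i = F 0 + F 1 + F 2.
Proof.
by rewrite !big_ord_recl big_ord0 addr0 -addrA; congr (_ + (F _ + F _));
  apply: val_inj.
Qed.

Lemma sum_ord4 (V : nmodType) (F : 'I_4 -> V) :
  \sum_i F i = F 0 + F 1 + F 2 + F 3.
Proof.
by rewrite !big_ord_recl big_ord0 addr0 -!addrA;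
  congr (_ + (F _ + (F _ + F _))); apply: val_inj.
Qed.

Lemma forall_ord4 (P : 'I_4 -> Prop) :
  P 0 -> P 1 -> P 2 -> P 3 -> forall i, P i.
Proof.
move=> P0 P1 P2 P3 [[|[|[|[|//]]]] lt_i];
  [move: P0 | move: P1 | move: P2 | move: P3]; congr P; exact: val_inj.
Qed.

(** * The 3-forms of the listed extensions *)

Section Models.
Variables (K : fieldType) (g : lieAlgType K) (B : {symmetric g}).
Hypothesis B_quad : quadratic B.
Implicit Types x y z : g.

(** The 3-form a /\ b /\ c, vectors being seen as linear forms through B. *)
Definition wedge (a b c x y z : g) : K :=
  B x a * (B y b * B z c - B z b * B y c)
  - B y a * (B x b * B z c - B z b * B x c)
  + B z a * (B x b * B y c - B y b * B x c).

Let fl := (functionalE, mxE).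

Lemma iso_abelian n (u v : 'I_n -> g) : hyperbolic B u v ->
  \dim {:g} = n.*2 -> (forall x y z, B (lie x y) z = 0) ->
  isometrically_isomorphic B (Tstar_form (abelian_lie K n)).
Proof.
move=> uv_c dim_g B0.
apply: (isometric_Tstar B_quad (X := fun i => 'e_i : abelian_lie K n)
  (xi := fun i => functional (entry_linear i) : 'Hom(abelian_lie K n, K^o))
  uv_c dim_g).
- by rewrite dimvf /dim /= mul1n.
- by move=> i j; rewrite !fl eqxx.
move=> x y z p q r _ _ _.
by rewrite B0 !big1 ?addr0 // => k _; rewrite !fl mulr0.
Qed.

Lemma iso_heisenberg (u v : 'I_3 -> g) : hyperbolic B u v -> \dim {:g} = 6 ->
  (forall x y z, B (lie x y) z = wedge (v 0) (v 1) (u 2) x y z) ->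
  isometrically_isomorphic B (Tstar_form (heisenberg K)).
Proof.
move=> uv_c dim_g B_I.
apply: (isometric_Tstar B_quad (X := fun i => 'e_i : heisenberg K)
  (xi := fun i => functional (entry_linear i) : 'Hom(heisenberg K, K^o))
  uv_c dim_g) => //.
- by rewrite dimvf /dim /= mul1n.
- by move=> i j; rewrite !fl eqxx.
move=> x y z p q r; rewrite B_I /wedge => xp yq zr.
by rewrite !sum_ord3 !fl -!xp -!yq -!zr !fl /=; ring.
Qed.

Definition hyperbolic4 (u0 u1 u2 u3 v0 v1 v2 v3 : g) := forall x y,
  B x y = B x u0 * B y v0 + B x v0 * B y u0 + B x u1 * B y v1 + B x v1 * B y u1
    + B x u2 * B y v2 + B x v2 * B y u2 + B x u3 * B y v3 + B x v3 * B y u3.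

Definition vec4 (T : Type) (a b c d : T) (i : 'I_4) : T :=
  nth a [:: a; b; c; d] i.

Lemma hyperbolic4W u0 u1 u2 u3 v0 v1 v2 v3 :
  hyperbolic4 u0 u1 u2 u3 v0 v1 v2 v3 ->
  hyperbolic B (vec4 u0 u1 u2 u3) (vec4 v0 v1 v2 v3).
Proof. by move=> uv x y; rewrite sum_ord4 uv /vec4 /=; ring. Qed.

Hypothesis dim_g : \dim {:g} = 8.

Lemma iso_filiform u0 u1 u2 u3 v0 v1 v2 v3 :
  hyperbolic4 u0 u1 u2 u3 v0 v1 v2 v3 ->
  (forall x y z,
     B (lie x y) z = wedge v0 v1 u2 x y z + wedge v0 v2 u3 x y z) ->
  isometrically_isomorphic B (Tstar_form (filiform K)).
Proof.
move=> /hyperbolic4W uv_c B_I.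
apply: (isometric_Tstar B_quad (X := fun i => 'e_i : filiform K)
  (xi := fun i => functional (entry_linear i) : 'Hom(filiform K, K^o))
  uv_c dim_g) => //.
- by rewrite dimvf /dim /= mul1n.
- by move=> i j; rewrite !fl eqxx.
move=> x y z p q r; rewrite B_I /wedge => xp yq zr.
have := (xp 0, xp 1, xp 2, yq 0, yq 1, yq 2, (zr 0, zr 1, zr 2)).
rewrite !fl /vec4 /= => E.
by rewrite !sum_ord4 !fl /= -!E; ring.
Qed.

Lemma entry_pair_linear (i : 'I_4) :
  linear (fun x : heisenberg K * abelian_lie K 1 =>
    vec4 (x.1 0 0) (x.1 0 1) (x.1 0 2) (x.2 0 0) i : K^o).
Proof. by move=> c x y; elim/forall_ord4: i; rewrite /vec4 /= !mxE. Qed.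

Lemma iso_heisenberg_sum u0 u1 u2 u3 v0 v1 v2 v3 :
  hyperbolic4 u0 u1 u2 u3 v0 v1 v2 v3 ->
  (forall x y z, B (lie x y) z = wedge v0 v1 u2 x y z) ->
  isometrically_isomorphic B
    (Tstar_form (heisenberg K * abelian_lie K 1)%type).
Proof.
move=> /hyperbolic4W uv_c B_I.
apply: (isometric_Tstar B_quad
  (X := vec4 ('e_0, 0) ('e_1, 0) ('e_2, 0) (0, 'e_0)
    : _ -> (heisenberg K * abelian_lie K 1)%type)
  (xi := fun i => functional (entry_pair_linear i)) uv_c dim_g) => //.
- by rewrite dimvf; change (1 * 3 + 1 * 1 = 4)%N.
- by move=> i j; elim/forall_ord4: i; elim/forall_ord4: j;
    rewrite functionalE /vec4 /= !mxE.
move=> x y z p q r; rewrite B_I /wedge => xp yq zr.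
have := (xp 0, xp 1, xp 2, yq 0, yq 1, yq 2, (zr 0, zr 1, zr 2)).
rewrite !fl /vec4 /= => E.
by rewrite !sum_ord4 !fl /= -!E; ring.
Qed.
End Models.

(** * Normal forms of the 3-form in dimension 8 *)

Section NormalForm.
Variables (K : fieldType) (g : lieAlgType K) (B : {symmetric g}).
Hypothesis B_quad : quadratic B.
Implicit Types x y z : g.

Definition classified : Prop :=
  [\/ exists2 n, (1 <= n <= 4)%N &
        isometrically_isomorphic B (Tstar_form (abelian_lie K n)),
      isometrically_isomorphic B (Tstar_form (heisenberg K)),
      isometrically_isomorphic B
        (Tstar_form (heisenberg K * abelian_lie K 1)%type) |
      isometrically_isomorphic B (Tstar_form (filiform K))].

Hypothesis dim_g : \dim {:g} = 8.

Local Ltac expand := rewrite !(hermDr, hermBr, hermNr, hermZr).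

(** Rescaling u_2 and u_3, with v_2 and v_3 inversely, turns non-zero s and t
    into 1; if s = 0, renumbering 2, 3, 1 as 1, 2, 3 gives the case of a
    single term. *)
Lemma classified_chain s t u0 u1 u2 u3 v0 v1 v2 v3 :
  hyperbolic4 B u0 u1 u2 u3 v0 v1 v2 v3 ->
  (forall x y z, B (lie x y) z
     = s * wedge B v0 v1 u2 x y z + t * wedge B v0 v2 u3 x y z) ->
  classified.
Proof.
move=> uv B_I.
have [s0 | s_neq0] := eqVneq s 0; have [t0 | t_neq0] := eqVneq t 0.
- constructor 1; exists 4 => //.
  apply: (iso_abelian B_quad (hyperbolic4W uv)) => //.
  by move=> x y z; rewrite B_I s0 t0 !mul0r addr0.
- constructor 3.
  apply: (@iso_heisenberg_sum _ _ _ B_quad dim_g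
    u0 u2 (t *: u3) u1 v0 v2 (t^-1 *: v3) v1) => [x y | x y z].
    by rewrite uv; expand; field.
  by rewrite B_I s0 /wedge; expand; ring.
- constructor 3.
  apply: (@iso_heisenberg_sum _ _ _ B_quad dim_g
    u0 u1 (s *: u2) u3 v0 v1 (s^-1 *: v2) v3) => [x y | x y z].
    by rewrite uv; expand; field.
  by rewrite B_I t0 /wedge; expand; ring.
constructor 4.
apply: (@iso_filiform _ _ _ B_quad dim_g
  u0 u1 (s *: u2) ((s * t) *: u3) v0 v1 (s^-1 *: v2) ((s * t)^-1 *: v3))
  => [x y | x y z].
  by rewrite uv; expand; field; rewrite s_neq0 t_neq0.
by rewrite B_I /wedge; expand; field.
Qed.

(** Every step is a change of hyperbolic basis: linear changes of the v_i, with
    the contragredient change of the u_i, and exchanges of some u_i with v_i. *)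
Lemma classified_top p t q r p' u0 u1 u2 u3 v0 v1 v2 v3 :
  hyperbolic4 B u0 u1 u2 u3 v0 v1 v2 v3 -> p * p' = 0 -> t * p' = 0 ->
  (forall x y z, B (lie x y) z
     = p * wedge B v0 v1 u2 x y z + t * wedge B v0 v1 u3 x y z
       + q * wedge B v0 v2 u3 x y z + r * wedge B v1 v2 u3 x y z
       + p' * wedge B u0 u1 v2 x y z) ->
  classified.
Proof.
move=> uv pp' tp' B_I.
(* Exchanging the indices 0 and 1 exchanges q and r. *)
wlog : p t q r p' u0 u1 v0 v1 uv pp' tp' B_I / (q != 0) || (r == 0).
  move=> IH; have [r0 | r_neq0] := eqVneq r 0.
    by apply: (IH p t q r p' u0 u1 v0 v1) => //; rewrite r0 eqxx orbT.
  apply: (IH (- p) (- t) r q (- p') u1 u0 v1 v0); rewrite ?r_neq0 //.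
  - by move=> x y; rewrite uv; ring.
  - by rewrite mulrNN.
  - by rewrite mulrNN.
  by move=> x y z; rewrite B_I /wedge; ring.
have [q0 /= /eqP r0 | q_neq0 _] := eqVneq q 0.
  have [p'0 | p'_neq0] := eqVneq p' 0.
    have [p0 | p_neq0] := eqVneq p 0.
      apply: (@classified_chain t 0 u0 u1 u3 u2 v0 v1 v3 v2) => [x y | x y z].
        by rewrite uv; ring.
      by rewrite B_I p0 q0 r0 p'0; ring.
    (* I = v0 /\ v1 /\ (p u2 + t u3). *)
    apply: (@classified_chain p 0 u0 u1 (u2 + (t / p) *: u3) u3
      v0 v1 v2 (v3 - (t / p) *: v2)) => [x y | x y z].
      by rewrite uv; expand; ring.
    by rewrite B_I q0 r0 p'0 /wedge; expand; field.
  move/eqP: pp'; rewrite mulf_eq0 (negPf p'_neq0) orbF => /eqP p0.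
  move/eqP: tp'; rewrite mulf_eq0 (negPf p'_neq0) orbF => /eqP t0.
  apply: (@classified_chain p' 0 v0 v1 v2 v3 u0 u1 u2 u3) => [x y | x y z].
    by rewrite uv; ring.
  by rewrite B_I p0 t0 q0 r0; ring.
have [p'0 | p'_neq0] := eqVneq p' 0; last first.
  move/eqP: pp'; rewrite mulf_eq0 (negPf p'_neq0) orbF => /eqP p0.
  move/eqP: tp'; rewrite mulf_eq0 (negPf p'_neq0) orbF => /eqP t0.
  (* I = p' u0 /\ u1 /\ v2 + (q v0 + r v1) /\ v2 /\ u3, where v2 is the factor
     common to both terms; u0 /\ u1 is rewritten with the vectors dual to
     q v0 + r v1 and v1. *)
  apply: (@classified_chain (- p' * q) (-1) u2 v1 (q^-1 *: u0) u3
    v2 (u1 - (r / q) *: u0) (q *: v0 + r *: v1) v3) => [x y | x y z].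
    by rewrite uv; expand; field.
  by rewrite B_I p0 t0 /wedge; expand; field.
have [p0 | p_neq0] := eqVneq p 0.
  (* The 2-form t v0 /\ v1 + q v0 /\ v2 + r v1 /\ v2 in three variables is
     (q v0 + r v1) /\ (v2 + (t / q) v1). *)
  apply: (@classified_chain 1 0 (q^-1 *: u0) u2 u3
    (u1 - (r / q) *: u0 - (t / q) *: u2)
    (q *: v0 + r *: v1) (v2 + (t / q) *: v1) v3 v1) => [x y | x y z].
    by rewrite uv; expand; field.
  by rewrite B_I p0 p'0 /wedge; expand; field.
(* I = v0 /\ v1 /\ (p u2 + t u3) + (q v0 + r v1) /\ v2 /\ u3, where v0 can be
   replaced by q v0 + r v1 in the first term, up to the factor q. *)
apply: (@classified_chain q^-1 p (q^-1 *: u0) (u1 - (r / q) *: u0)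
  (p *: u2 + t *: u3) u3
  (q *: v0 + r *: v1) v1 (p^-1 *: v2) (v3 - (t / p) *: v2)) => [x y | x y z].
  by rewrite uv; expand; field; rewrite p_neq0 q_neq0.
by rewrite B_I p'0 /wedge; expand; field; rewrite p_neq0 q_neq0.
Qed.
End NormalForm.

(** * Triangular structure constants *)

Section Contract.
Variables (K : fieldType) (n : nat).
Implicit Types (c : 'I_n -> 'I_n -> 'I_n -> K) (X Y Z : 'I_n -> K).

Definition triangular c :=
  forall i j k, c i j k != 0 -> (i < k)%N && (j < k)%N.

Definition contract c X Y Z :=
  \sum_i \sum_j \sum_k X i * Y j * Z k * c i j k.

Lemma triangular0 c (i j k : 'I_n) :
  triangular c -> (forall i k, c i i k = 0) ->
  ~~ [&& (i < k)%N, (j < k)%N & i != j] -> c i j k = 0.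
Proof.
move=> c_tri c_diag; have [-> _ | ij] := eqVneq i j; first exact: c_diag.
by rewrite andbT; apply: contraNeq => /c_tri.
Qed.

Lemma contract_le2 c X Y Z :
  triangular c -> (forall i k, c i i k = 0) -> (n <= 2)%N ->
  contract c X Y Z = 0.
Proof.
move=> c_tri c_diag n2; rewrite /contract.
rewrite big1 // => i _; rewrite big1 // => j _; rewrite big1 // => k _.
rewrite (triangular0 c_tri) ?mulr0 //; apply/and3P => -[ik jk /negP[]].
(* Both i and j are less than k < 2. *)
have k_le1 : (k <= 1)%N by rewrite -ltnS (leq_trans (ltn_ord k)).
have i0 := leq_trans ik k_le1; have j0 := leq_trans jk k_le1.
by rewrite -val_eqE /=; move: i0 j0; rewrite !ltnS !leqn0 => /eqP-> /eqP->.
Qed.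
End Contract.

(* The condition of a vanishing lemma [c0] such as [triangular0] is decided by
   computation on explicit indices. *)
Local Ltac kill_zeros c0 c :=
  repeat match goal with |- context [c ?i ?j ?k] =>
    rewrite (c0 i j k isT) end.

Lemma contract3 (K : fieldType) (c : 'I_3 -> 'I_3 -> 'I_3 -> K) X Y Z :
  triangular c -> (forall i j k, c i j k = - c j i k) ->
  (forall i k, c i i k = 0) ->
  contract c X Y Z = c 0 1 2 * (X 0 * Y 1 - X 1 * Y 0) * Z 2.
Proof.
move=> c_tri cC c_diag.
have c0 i j k := triangular0 (i := i) (j := j) (k := k) c_tri c_diag.
by rewrite /contract !sum_ord3; kill_zeros c0 c; rewrite (cC 1 0); ring.
Qed.

Lemma contract4 (K : fieldType) (c : 'I_4 -> 'I_4 -> 'I_4 -> K) X Y Z :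
  triangular c -> (forall i j k, c i j k = - c j i k) ->
  (forall i k, c i i k = 0) ->
  contract c X Y Z = c 0 1 2 * (X 0 * Y 1 - X 1 * Y 0) * Z 2
    + (c 0 1 3 * (X 0 * Y 1 - X 1 * Y 0) + c 0 2 3 * (X 0 * Y 2 - X 2 * Y 0)
       + c 1 2 3 * (X 1 * Y 2 - X 2 * Y 1)) * Z 3.
Proof.
move=> c_tri cC c_diag.
have c0 i j k := triangular0 (i := i) (j := j) (k := k) c_tri c_diag.
rewrite /contract !sum_ord4; kill_zeros c0 c.
by rewrite (cC 1 0 2) (cC 1 0 3) (cC 2 0 3) (cC 2 1 3); ring.
Qed.

(** * Classification from a frame *)

Section Frames.
Variables (K : fieldType) (g : lieAlgType K) (B : {symmetric g}).
Hypothesis B_quad : quadratic B.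
Implicit Types x y z : g.

(** With the antisymmetry of the bracket, this makes B([x, y], z) an
    alternating 3-form. *)
Lemma triple_cyc x y z : B (lie x y) z = B (lie y z) x.
Proof. by case: B_quad => _ ->; apply: symC. Qed.

(** The Jacobi identity paired with w. *)
Lemma triple_jacobi x y z w :
  B (lie x y) (lie z w) + B (lie y z) (lie x w) + B (lie z x) (lie y w) = 0.
Proof.
case: B_quad => _ B_inv; rewrite -!B_inv -!hermDl.
suff -> : lie (lie x y) z + lie (lie y z) x + lie (lie z x) y = 0.
  exact: herm0l.
rewrite !(lieC (lie _ _)) -!opprD -addrA addrC.
by apply/eqP; rewrite oppr_eq0; apply/eqP; exact: lie_jacobi.
Qed.

Definition structure_const n (e f : 'I_n -> g) i j k :=
  B (lie (e i) (e j)) (f k).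

(** When dim g = 2n, the spans of [e] and [f] are isotropic subalgebras in
    duality, which is a Manin triple: [structure_const e f] is the bracket of a
    Lie bialgebra, and [structure_const f e] its cobracket. *)
Record bialgebra_frame n (e f : 'I_n -> g) := BialgebraFrame {
  frame_hyperbolic : hyperbolic B e f;
  frame_eee : forall i j k, B (lie (e i) (e j)) (e k) = 0;
  frame_fff : forall i j k, B (lie (f i) (f j)) (f k) = 0;
  frame_c : triangular (structure_const e f);
  frame_d : triangular (structure_const f e) }.

Lemma frame_swap n (e f : 'I_n -> g) :
  bialgebra_frame e f -> bialgebra_frame f e.
Proof.
case=> ef_c eee fff c d; split=> // x y.
by rewrite ef_c; apply: eq_bigr => i _; rewrite addrC.
Qed.

Section OneFrame.
Variables (n : nat) (e f : 'I_n -> g).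
Hypothesis ef : bialgebra_frame e f.

Let c := structure_const e f.
Let d := structure_const f e.

Lemma structure_constC i j k : c i j k = - c j i k.
Proof. by rewrite /c /structure_const lieC hermNl. Qed.

Lemma structure_const_diag i k : c i i k = 0.
Proof. by rewrite /c /structure_const lie_alternating herm0l. Qed.

(** The Jacobi identity on e_i, e_j, f_k, f_l: the cobracket of a Lie bialgebra
    is a 1-cocycle. *)
Lemma structure_const_cocycle i j k l :
  \sum_m (c i j m * d k l m + d k m j * c m i l + c m j k * d l m i
    - d k m i * c m j l - c m i k * d l m j) = 0.
Proof.
have := triple_jacobi (e i) (e j) (f k) (f l).
rewrite (lieC (f k) (e i)) hermNl !(frame_hyperbolic ef) -!big_split -sumrB /=.
move=> {2}<-; apply: eq_bigr => m _.
rewrite !(frame_eee ef) !(frame_fff ef).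
rewrite -!(triple_cyc (e m)) !(triple_cyc (e _) (f _) (f _)).
rewrite /c /d /structure_const; ring.
Qed.

(** Split x, y and z along the two halves: I vanishes on three vectors of the
    same half, and its cyclic symmetry brings the odd one to the last place. *)
Lemma triple_expand x y z
    (X := fun i => B x (f i)) (Y := fun i => B y (f i))
    (Z := fun i => B z (f i)) (X' := fun i => B x (e i))
    (Y' := fun i => B y (e i)) (Z' := fun i => B z (e i)) :
  B (lie x y) z =
    contract c X Y Z' + contract c Y Z X' + contract c Z X Y'
    + (contract d X' Y' Z + contract d Y' Z' X + contract d Z' X' Y).
Proof.
case: (B_quad) => B_nd _.
pose up (v w : 'I_n -> g) t := \sum_i B t (w i) *: v i.
have split_vec t : t = up e f t + up f e t.
  apply: (herm_ext B_nd) => s; rewrite (frame_hyperbolic ef t s) hermDl.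
  rewrite !herm_suml -big_split; apply: eq_bigr => i _ /=.
  by rewrite !hermZl !(symC B s) addrC; ring.
have eee t1 t2 t3 : B (lie (up e f t1) (up e f t2)) (up e f t3) = 0.
  rewrite lie_suml herm_suml big1 // => i _.
  rewrite lie_sumr herm_suml big1 // => j _.
  rewrite herm_sumr big1 // => k _.
  by rewrite lieZl lieZr !hermZl hermZr (frame_eee ef) !mulr0.
have fff t1 t2 t3 : B (lie (up f e t1) (up f e t2)) (up f e t3) = 0.
  rewrite lie_suml herm_suml big1 // => i _.
  rewrite lie_sumr herm_suml big1 // => j _.
  rewrite herm_sumr big1 // => k _.
  by rewrite lieZl lieZr !hermZl hermZr (frame_fff ef) !mulr0.
have eef (v w : 'I_n -> g) t1 t2 t3 :
    B (lie (up v w t1) (up v w t2)) (up w v t3) =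
    contract (structure_const v w) (fun i => B t1 (w i)) (fun i => B t2 (w i))
      (fun i => B t3 (v i)).
  rewrite lie_suml herm_suml; apply: eq_bigr => i _.
  rewrite lie_sumr herm_suml; apply: eq_bigr => j _.
  rewrite herm_sumr; apply: eq_bigr => k _.
  by rewrite lieZl lieZr !hermZl hermZr /structure_const; ring.
rewrite /c /d -!eef {1}(split_vec x) {1}(split_vec y) {1}(split_vec z).
rewrite !(lieDl, lieDr, hermDl, hermDr) eee fff.
rewrite (triple_cyc (up e f x) (up f e y) (up f e z)).
rewrite -(triple_cyc (up e f z) (up e f x) (up f e y)).
rewrite (triple_cyc (up f e x) (up e f y) (up e f z)).
rewrite -(triple_cyc (up f e z) (up f e x) (up e f y)).
ring.
Qed.

Let c_tri : triangular c := frame_c ef.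
Let d_tri : triangular d := frame_d ef.
Let d_diag i k : d i i k = 0.
Proof. by rewrite /d /structure_const lie_alternating herm0l. Qed.

Lemma frame_le2_classified :
  \dim {:g} = n.*2 -> (0 < n <= 2)%N -> classified B.
Proof.
move=> dim_g /andP[n_gt0 n_le2]; constructor 1; exists n.
  by rewrite n_gt0 (leq_trans n_le2).
apply: (iso_abelian B_quad (frame_hyperbolic ef)) => // x y z.
rewrite triple_expand !(contract_le2 _ _ _ c_tri structure_const_diag) //.
by rewrite !(contract_le2 _ _ _ d_tri d_diag) // !addr0.
Qed.

End OneFrame.

Lemma structure_const0 n (e f : 'I_n -> g) (i j k : 'I_n) :
  bialgebra_frame e f -> ~~ [&& (i < k)%N, (j < k)%N & i != j] ->
  structure_const e f i j k = 0.
Proof.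
by move=> ef; apply: (triangular0 (frame_c ef)); apply: structure_const_diag.
Qed.

(** The cocycle condition on (0, 1, 0, 1) reads c_012 d_012 = 0. *)
Lemma frame3_classified (e f : 'I_3 -> g) :
  bialgebra_frame e f -> \dim {:g} = 6 -> classified B.
Proof.
move=> ef dim_g.
wlog: e f ef / structure_const f e 0 1 2 = 0.
  move=> IH; have fe := frame_swap ef.
  have cocycle := structure_const_cocycle ef 0 1 0 1.
  have c0 i j k := structure_const0 (i := i) (j := j) (k := k) ef.
  have d0 i j k := structure_const0 (i := i) (j := j) (k := k) fe.
  have : structure_const e f 0 1 2 * structure_const f e 0 1 2 = 0.
    rewrite -cocycle sum_ord3; kill_zeros c0 (structure_const e f).
    by kill_zeros d0 (structure_const f e); ring.
  move=> /eqP; rewrite mulf_eq0 => /orP[] /eqP cd0; last exact: (IH e f).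
  exact: (IH f e).
move=> d0; set p := structure_const e f 0 1 2.
have B_I x y z : B (lie x y) z = p * wedge B (f 0) (f 1) (e 2) x y z.
  rewrite (triple_expand ef) !contract3 ?d0;
    try exact: frame_c; try exact: frame_d;
    try exact: structure_const_diag; try exact: structure_constC.
  by rewrite -/p /wedge; ring.
have [p0 | p_neq0] := eqVneq p 0.
  constructor 1; exists 3 => //.
  apply: (iso_abelian B_quad (frame_hyperbolic ef)) => // x y z.
  by rewrite B_I p0 mul0r.
constructor 2.
apply: (iso_heisenberg B_quad (u := fun i => (if i == 2 then p else 1) *: e i)
  (v := fun i => (if i == 2 then p^-1 else 1) *: f i)) => // x y.
  rewrite (frame_hyperbolic ef) !sum_ord3 /= !hermZr; field.
  exact: p_neq0.
by move=> z; rewrite B_I /wedge /= !hermZr; ring.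
Qed.

Lemma half_frame4_classified (e f : 'I_4 -> g)
    (c := structure_const e f) (d := structure_const f e) :
  bialgebra_frame e f -> \dim {:g} = 8 ->
  d 0 1 3 = 0 -> d 0 2 3 = 0 -> d 1 2 3 = 0 ->
  c 0 1 2 * d 0 1 2 = 0 -> c 0 1 3 * d 0 1 2 = 0 -> classified B.
Proof.
move=> ef dim_g d013 d023 d123 pp' tp'.
apply: (@classified_top _ _ _ B_quad dim_g _ _ (c 0 2 3) (c 1 2 3) _
  (e 0) (e 1) (e 2) (e 3) (f 0) (f 1) (f 2) (f 3) _ pp' tp') => [x y | x y z].
  by rewrite (frame_hyperbolic ef) sum_ord4; ring.
rewrite (triple_expand ef) -/c -/d !contract4 ?d013 ?d023 ?d123;
  try exact: frame_c; try exact: frame_d;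
  try exact: structure_const_diag; try exact: structure_constC.
by rewrite /wedge; ring.
Qed.

(** Write p, t, q, r for the constants c_012, c_013, c_023, c_123, and p', t',
    q', r' for those of d. The cocycle conditions give
    p p' = p t' = t p' = 0 and make all products of one of t, q, r by one of
    t', q', r' vanish, so that one of these triples is zero. *)
Lemma frame4_classified (e f : 'I_4 -> g) :
  (2 : K) != 0 -> bialgebra_frame e f -> \dim {:g} = 8 -> classified B.
Proof.
move=> two_neq0 ef dim_g; have fe := frame_swap ef.
pose c := structure_const e f; pose d := structure_const f e.
have cC i j k : c i j k = - c j i k := structure_constC e f i j k.
have dC i j k : d i j k = - d j i k := structure_constC f e i j k.
have c0 i j k := structure_const0 (i := i) (j := j) (k := k) ef.
have d0 i j k := structure_const0 (i := i) (j := j) (k := k) fe.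
have coc i j k l := structure_const_cocycle ef i j k l.
rewrite -/c in c0 coc; rewrite -/d in d0 coc.
move: (coc 0 1 0 1) (coc 0 2 0 2) (coc 1 2 1 2) (coc 2 3 2 3).
move: (coc 0 2 1 2) (coc 1 2 0 2) (coc 0 3 0 2) (coc 0 2 0 3).
move: (coc 0 2 0 1) (coc 0 1 0 2) (coc 1 2 0 1) (coc 0 1 1 2).
rewrite !sum_ord4.
kill_zeros c0 c; kill_zeros d0 d.
rewrite !(mul0r, mulr0, oppr0, add0r, addr0, subr0).
rewrite ?(cC 1 0) ?(cC 2 0) ?(cC 2 1) ?(dC 1 0) ?(dC 2 0) ?(dC 2 1).
set p := c 0 1 2; set t := c 0 1 3; set q := c 0 2 3; set r := c 1 2 3.
set p' := d 0 1 2; set t' := d 0 1 3; set q' := d 0 2 3; set r' := d 1 2 3.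
move=> qt' tq' rt' tr' qr' rq' pt' tp' E1 E2 E3 E4.
(* Adding up E2, E3 and E4 leaves - 2 p p'. *)
have pp' : p * p' = 0.
  apply: (mulfI two_neq0); rewrite mulr0.
  have -> : 2 * (p * p') = - (p' * - p + q * q') - (- p' * p + r * r')
    - (- q' * q + - r' * r) by ring.
  by rewrite E2 E3 E4 !subr0 oppr0.
have p'p : p' * p = 0 by rewrite mulrC.
have qq' : q * q' = 0 by rewrite -[RHS]E2 mulrN p'p oppr0 add0r.
have rr' : r * r' = 0 by rewrite -[RHS]E3 mulNr p'p oppr0 add0r.
have tt' : t * t' = 0 by rewrite -[RHS]E1 pp' add0r.
have {}pt' : t' * p = 0 by apply/eqP; rewrite -oppr_eq0 -mulrN pt'.
have {}tp' : t * p' = 0 by apply/eqP; rewrite mulrC -oppr_eq0 -mulrN tp'.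
have zero2 (x y : K) : x * y = 0 -> x != 0 -> y = 0.
  by move=> /eqP; rewrite mulf_eq0 => /orP[/eqP-> /eqP | /eqP].
have [t0 | /zero2 z] := eqVneq t 0; last first.
  by apply: (half_frame4_classified ef) => //; exact: z.
have [q0 | /zero2 z] := eqVneq q 0; last first.
  by apply: (half_frame4_classified ef) => //; exact: z.
have [r0 | /zero2 z] := eqVneq r 0; last first.
  by apply: (half_frame4_classified ef) => //; exact: z.
by apply: (half_frame4_classified fe) => //; rewrite mulrC.
Qed.

End Frames.

(** * Lexicographic order on the complex numbers *)

Section Positive.
Variable K : numClosedFieldType.
Implicit Types a b : K.

(** The positive cone of a total order compatible with addition; the usual order
    on a closed field is only partial. *)
Definition pos a := (0 < 'Re a) || (('Re a == 0) && (0 < 'Im a)).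

Lemma posD a b : pos a -> pos b -> pos (a + b).
Proof.
rewrite /pos !raddfD /=.
move=> /orP[a0 | /andP[/eqP-> a0]] /orP[b0 | /andP[/eqP-> b0]].
- by rewrite addr_gt0.
- by rewrite addr0 a0.
- by rewrite add0r b0.
by rewrite add0r eqxx addr_gt0 ?orbT.
Qed.

Lemma pos_asym a : pos a -> ~~ pos (- a).
Proof.
by move=> pa; apply/negP => /(posD pa); rewrite subrr /pos !raddf0 ltxx andbF.
Qed.

Lemma pos_total a : a != 0 -> pos a || pos (- a).
Proof.
rewrite /pos !raddfN /= !oppr_gt0 oppr_eq0.
case: (real_ltgtP (Creal_Re a) (real0 K)) => //= Re0.
case: (real_ltgtP (Creal_Im a) (real0 K)) => //= Im0.
by rewrite [a]Crect Re0 Im0 mulr0 addr0 eqxx.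
Qed.

Lemma pos_neq0 a : pos a -> a != 0.
Proof. by apply: contraTneq => ->; rewrite /pos !raddf0 ltxx andbF. Qed.

Definition pos_le a b := (a == b) || pos (b - a).

Lemma pos_le_total : total pos_le.
Proof.
move=> a b; rewrite /pos_le [b == a]eq_sym; have [-> // | ab] := eqVneq a b.
by rewrite /= -(opprB b a); apply: pos_total; rewrite subr_eq0 eq_sym.
Qed.

Lemma pos_le_trans : transitive pos_le.
Proof.
move=> b a c; rewrite /pos_le => /orP[/eqP-> // | ab] /orP[/eqP<- | bc].
  by rewrite ab orbT.
have -> : c - a = b - a + (c - b) by ring.
by rewrite posD ?orbT.
Qed.
End Positive.

(** * Generalized eigenvectors *)

Section Weights.
Variables (K : fieldType) (V : vectType K) (D : 'End(V)).
Implicit Types (a b : K) (x y : V).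

Definition shift a x := D x - a *: x.

(** [x] is a generalized eigenvector of [D] for the eigenvalue [a], or 0. *)
Definition weight a x := exists m, iter m (shift a) x = 0.

Lemma shift_linear a c x y : shift a (c *: x + y) = c *: shift a x + shift a y.
Proof.
rewrite /shift linearP scalerBr scalerDr !scalerA [a * c]mulrC.
by rewrite opprD addrACA.
Qed.

Lemma iter_shift_linear a m c x y :
  iter m (shift a) (c *: x + y) = c *: iter m (shift a) x + iter m (shift a) y.
Proof. by elim: m => //= m ->; rewrite shift_linear. Qed.

Lemma shift0 a : shift a 0 = 0.
Proof. by rewrite /shift linear0 scaler0 subrr. Qed.

Lemma iter_shift0 a m : iter m (shift a) 0 = 0.
Proof. by elim: m => //= m ->; exact: shift0. Qed.

Lemma weight0 a : weight a 0.
Proof. by exists 0. Qed.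

Lemma weightP a c x y : weight a x -> weight a y -> weight a (c *: x + y).
Proof.
move=> [m mx] [n ny]; exists (m + n)%N; rewrite iter_shift_linear.
by rewrite {1}addnC !iterD mx ny !iter_shift0 scaler0 addr0.
Qed.

Lemma weightZ a c x : weight a x -> weight a (c *: x).
Proof. by move=> ax; rewrite -[_ *: _]addr0; apply: weightP (weight0 a). Qed.

Lemma weightD a x y : weight a x -> weight a y -> weight a (x + y).
Proof. by rewrite -{2}[x]scale1r; apply: weightP. Qed.

Lemma weightB a x y : weight a x -> weight a y -> weight a (x - y).
Proof. by move=> ax ay; rewrite addrC -scaleN1r; apply: weightP. Qed.

Lemma weight_shift a x : weight a (shift a x) -> weight a x.
Proof. by case=> m mx; exists m.+1; rewrite iterSr. Qed.

(** D - a = (D - b) + (b - a) is a nilpotent map plus a non-zero scalar on the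
    generalized eigenspace of b; the preimage is built by induction on the
    nilpotency order. *)
Lemma shift_surj a b y : b != a -> weight b y ->
  exists2 z, weight b z & shift a z = y.
Proof.
move=> ba [m]; elim: m y => [|m IHm] y; first by move=> /= ->; exists 0;
  [exact: weight0 | exact: (shift0 a)].
rewrite iterSr => /IHm[z bz Dz].
have ba0 : b - a != 0 by rewrite subr_eq0.
have bz' : weight b (shift a z).
  have -> : shift a z = shift b z + (b - a) *: z.
    by rewrite /shift scalerBl addrA subrK.
  apply: weightD; last exact: weightZ.
  by case: bz => m' mz; exists m'; rewrite -iterSr iterS mz shift0.
have b_y : weight b y by apply: weight_shift; rewrite -Dz.
exists ((b - a)^-1 *: (y - z)); first by apply: weightZ; apply: weightB.
rewrite -[_ *: _]addr0 shift_linear shift0 addr0.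
rewrite -[y - z]addrC -scaleN1r shift_linear Dz.
have -> : shift a y = shift b y + (b - a) *: y.
  by rewrite /shift scalerBl addrA subrK.
by rewrite scaleN1r addKr scalerA mulVf // scale1r.
Qed.

Definition weight_sum x := exists2 X : seq V,
  (forall v, v \in X -> exists a, weight a v) & x = \sum_(v <- X) v.

Lemma weight_sum0 : weight_sum 0.
Proof. by exists [::]; rewrite ?big_nil. Qed.

Lemma weight_sum_cons a x y : weight a x -> weight_sum y -> weight_sum (x + y).
Proof.
move=> ax [X wX ->]; exists (x :: X); last by rewrite big_cons.
by move=> v; rewrite inE => /orP[/eqP-> | /wX //]; exists a.
Qed.

(** The components of [y] at eigenvalues other than [a] are in the image of
    D - a. *)
Lemma shift_weight_sum a y : weight_sum y ->
  exists2 z, weight_sum z & weight a (y - shift a z).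
Proof.
case=> X wX ->; elim: X wX => [|x X IHX] wX.
  exists 0; first exact: weight_sum0.
  by rewrite big_nil shift0 subrr; exact: weight0.
have [z sz az] := IHX (fun v vX => wX v (@mem_behead _ (x :: X) v vX)).
have [b bx] := wX x (mem_head x X); rewrite big_cons.
have [ba | ba] := eqVneq b a.
  by exists z => //; rewrite -addrA; apply: weightD => //; rewrite -ba.
have [z' bz' Dz'] := shift_surj ba bx.
exists (z' + z); first exact: weight_sum_cons bz' sz.
by rewrite -[z']scale1r shift_linear scale1r Dz' opprD addrACA subrr add0r.
Qed.

(** Induction on the number of factors: if (D - a) x is a sum of generalized
    eigenvectors, subtracting from x preimages of the components at eigenvalues
    other than [a] leaves a vector that (D - a) sends to a generalized
    eigenvector for [a]. *)
Lemma annihilated_weight_sum (s : seq K) x :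
  foldl (fun y a => shift a y) x s = 0 -> weight_sum x.
Proof.
elim: s x => [|a s IHs] x /=; first by move=> ->; exact: weight_sum0.
move=> /IHs /(shift_weight_sum a)[z sz az].
rewrite -[x](subrK z); apply: (@weight_sum_cons a) (sz); apply: weight_shift.
have -> : shift a (x - z) = shift a x - shift a z; last by [].
by rewrite addrC -scaleN1r shift_linear scaleN1r addrC.
Qed.
End Weights.

(* For the matrix of an endomorphism and the coordinate isomorphisms. *)
Import VectorInternalTheory.

(** Cayley-Hamilton, the characteristic polynomial being split. *)
Lemma matrix_annihilator (K : closedFieldType) n (A : 'M[K]_n) :
  exists s : seq K, forall u : 'rV_n,
    foldl (fun v a => v *m A - a *: v) u s = 0.
Proof.
case: n A => [|n] A; first by exists [::] => u; apply: thinmx0.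
have [s char_s] := closed_field_poly_normal (char_poly A).
rewrite (monicP (char_poly_monic A)) scale1r in char_s.
have A0 : \prod_(a <- s) (A - a%:M) = 0.
  rewrite -(Cayley_Hamilton A) char_s rmorph_prod; apply: eq_bigr => a _.
  by rewrite rmorphB /= horner_mx_X horner_mx_C.
exists s => u; rewrite -[RHS](mulmx0 _ u) -A0.
elim: {char_s A0} s u => [|a s IHs] u /=; first by rewrite big_nil mulmx1.
by rewrite IHs big_cons mulmxA mulmxBr mul_mx_scalar.
Qed.

Lemma weight_span (K : closedFieldType) (V : vectType K) (D : 'End(V)) x :
  weight_sum D x.
Proof.
have [s sD] := matrix_annihilator (f2mx D).
apply: (@annihilated_weight_sum _ _ _ s).
apply: (can_inj (@v2rK _ _)); rewrite linear0 -(sD (v2r x)).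
elim: {sD} s x => //= a s IHs x; rewrite IHs linearB linearZ /=; congr foldl.
by congr (_ - _); rewrite unlock /= r2vK.
Qed.

(** * The derivation attached to a symplectic structure *)

Section Derivation.
Variables (K : fieldType) (g : lieAlgType K).
Variables (B : {symmetric g}) (w : {skew_symmetric g}).
Hypotheses (B_quad : quadratic B) (w_symp : symplectic w).

Lemma form_linearr eps (f : {hermitian g for eps & idfun}) x :
  linear (f x : g -> K^o).
Proof. by move=> c y z; rewrite hermDr hermZr. Qed.

Lemma form_linearl eps (f : {hermitian g for eps & idfun}) :
  linear (fun x => functional (form_linearr f x)).
Proof.
move=> c x y; apply/lfunP => z.
by rewrite add_lfunE scale_lfunE !functionalE hermDl hermZl.
Qed.

Definition to_dual eps (f : {hermitian g for eps & idfun}) :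
    'Hom(g, 'Hom(g, K^o)) :=
  linfun (HB.pack (fun x => functional (form_linearr f x))
    (GRing.isLinear.Build K g 'Hom(g, K^o) _ _ (form_linearl f))
    : {linear g -> 'Hom(g, K^o)}).

Lemma to_dualE eps (f : {hermitian g for eps & idfun}) x y :
  to_dual f x y = f x y.
Proof. by rewrite lfunE functionalE. Qed.

(** D is the endomorphism with w(x, y) = B(D x, y). The derivation property is
    stated through the 3-form B([x, y], z), which is what it is used for. *)
Lemma exists_skew_derivation : exists D : 'End(g),
  [/\ forall x, D x = 0 -> x = 0,
      forall x y, B (D x) y + B x (D y) = 0 &
      forall x y z,
        B (lie (D x) y) z + B (lie x (D y)) z + B (lie x y) (D z) = 0].
Proof.
have [[B_nd _] [w_nd w_cyc]] := (B_quad, w_symp).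
have dual_inj : injective (to_dual B).
  by move=> x y Bxy; apply: (herm_ext B_nd) => z; rewrite -!to_dualE Bxy.
have [dual_inv _ dual_invK] := inj_lfun_bij (esym (dim_dual g)) dual_inj.
have dualK x : to_dual B ((to_dual B)^-1%VF x) = x.
  by rewrite limg_lfunVK // -[x]dual_invK; apply/memv_img/memvf.
pose D : 'End(g) := ((to_dual B)^-1 \o to_dual w)%VF.
have BD x y : B (D x) y = w x y.
  by rewrite -to_dualE comp_lfunE dualK to_dualE.
have BDr x y : B x (D y) = - w x y by rewrite symC BD skewC.
exists D; split=> [x Dx0 | x y | x y z].
- by apply: (herm_ext w_nd) => y; rewrite -BD Dx0 !herm0l.
- by rewrite BD BDr subrr.
rewrite (triple_cyc B_quad (D x)) -(triple_cyc B_quad z x (D y)) !BDr -!opprD.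
by apply/eqP; rewrite oppr_eq0 addrC addrA w_cyc.
Qed.
End Derivation.

(** * A basis of weight vectors adapted to the form *)

Lemma span_closed (K : fieldType) (V : vectType K) (X : seq V) (P : V -> Prop) :
  P 0 -> (forall c x y, P x -> P y -> P (c *: x + y)) ->
  (forall x, x \in X -> P x) -> forall x, x \in <<X>>%VS -> P x.
Proof.
move=> P0 Plin PX x /(@coord_span _ _ _ (in_tuple X)) ->.
have PD y z : P y -> P z -> P (y + z) by rewrite -{2}[y]scale1r; apply: Plin.
apply: big_ind => // i _; rewrite -[_ *: _]addr0; apply: Plin => //.
by apply: PX; rewrite mem_nth.
Qed.

Lemma weight_basis (K : closedFieldType) (V : vectType K) (D : 'End(V)) :
  exists2 X : seq V, (forall v, v \in X -> exists a, weight D a v) &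
    <<X>>%VS = fullv.
Proof.
have weights_over (s : seq V) : exists2 X : seq V,
    (forall v, v \in X -> exists a, weight D a v) &
    forall v, v \in s -> v \in <<X>>%VS.
  elim: s => [|x s [X wX sX]]; first by exists [::].
  have [Y wY xY] := weight_span D x.
  exists (Y ++ X) => [v | v].
    by rewrite mem_cat => /orP[/wY | /wX].
  rewrite inE span_cat => /orP[/eqP-> | /sX vX]; last first.
    exact: (subvP (addvSr <<Y>> <<X>>)).
  apply: (subvP (addvSl <<Y>> <<X>>)); rewrite xY big_seq.
  by apply: memv_suml => u uY; apply: memv_span.
have [X wX sX] := weights_over (vbasis {:V}).
exists X => //; apply/eqP; rewrite eqEsubv subvf /=.
by rewrite -(span_basis (vbasisP fullv)); apply/span_subvP.
Qed.

Section Invariant.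
Variables (K : fieldType) (g : lieAlgType K) (B : {symmetric g}).
Variable D : 'End(g).
Hypothesis D_skew : forall x y, B (D x) y + B x (D y) = 0.
Hypothesis D_der : forall x y z,
  B (lie (D x) y) z + B (lie x (D y)) z + B (lie x y) (D z) = 0.

(** For true eigenvectors, (a + b) B(x, y) = B(D x, y) + B(x, D y) = 0. In
    general, the same computation holds modulo values of B at vectors of smaller
    nilpotency order, which vanish by induction. *)
Lemma form_weight0 a b x y :
  weight D a x -> weight D b y -> a + b != 0 -> B x y = 0.
Proof.
move=> [m mx] [n ny] ab0.
have [N le_N] := ubnP (m + n); elim: N => // N IHN in m n x y mx ny le_N *.
case: m mx le_N => [/= -> | m]; first by rewrite herm0l.
case: n ny => [/= -> | n]; first by rewrite herm0r.
move=> ny mx le_N.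
have I1 : B (shift D a x) y = 0 by apply: (IHN m n.+1); rewrite -?iterSr.
have I2 : B x (shift D b y) = 0.
  by apply: (IHN m.+1 n); rewrite -?iterSr // addSnnS.
have := D_skew x y; move: I1 I2; rewrite /shift hermBl hermBr hermZl hermZr.
move=> /eqP; rewrite subr_eq0 => /eqP ->.
move=> /eqP; rewrite subr_eq0 => /eqP ->.
by rewrite -mulrDl => /eqP; rewrite mulf_eq0 (negPf ab0) /= => /eqP.
Qed.

(** The argument of [form_weight0], with the 3-form in place of B. *)
Lemma triple_weight0 a b c x y z : weight D a x -> weight D b y ->
  weight D c z -> a + b + c != 0 -> B (lie x y) z = 0.
Proof.
move=> [m mx] [n ny] [k kz] abc0.
have [N le_N] := ubnP (m + n + k).
elim: N => // N IHN in m n k x y z mx ny kz le_N *.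
case: m mx le_N => [/= -> | m]; first by rewrite linear0l herm0l.
case: n ny => [/= -> | n]; first by rewrite linear0r herm0l.
case: k kz => [/= -> | k]; first by rewrite herm0r.
move=> kz ny mx le_N.
rewrite !(addSn, addnS) in le_N.
have I1 : B (lie (shift D a x) y) z = 0.
  by apply: (IHN m n.+1 k.+1); rewrite -?iterSr // !(addSn, addnS).
have I2 : B (lie x (shift D b y)) z = 0.
  by apply: (IHN m.+1 n k.+1); rewrite -?iterSr // !(addSn, addnS).
have I3 : B (lie x y) (shift D c z) = 0.
  by apply: (IHN m.+1 n.+1 k); rewrite -?iterSr // !(addSn, addnS).
have := D_der x y z; move: I1 I2 I3.
rewrite /shift lieBl lieBr lieZl lieZr !(hermBl, hermBr) !(hermZl, hermZr).
move=> /eqP; rewrite subr_eq0 => /eqP ->.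
move=> /eqP; rewrite subr_eq0 => /eqP ->.
move=> /eqP; rewrite subr_eq0 => /eqP ->.
by rewrite -!mulrDl => /eqP; rewrite mulf_eq0 (negPf abc0) /= => /eqP.
Qed.
End Invariant.

Section Hyperbolic.
Variables (K : numClosedFieldType) (g : lieAlgType K) (B : {symmetric g}).
Variable D : 'End(g).
Hypothesis D_inj : forall x, D x = 0 -> x = 0.
Hypothesis D_skew : forall x y, B (D x) y + B x (D y) = 0.

Lemma weight0_eq0 x : weight D 0 x -> x = 0.
Proof.
case=> m; elim: m => //= m IHm; rewrite {1}/shift scale0r subr0.
by move=> /D_inj.
Qed.

Lemma form_weight_eq a b x y :
  weight D a x -> weight D b y -> B x y != 0 -> b = - a.
Proof.
move=> ax byy; apply: contraNeq; rewrite -addr_eq0 addrC.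
by move=> ab0; apply/eqP; apply: (form_weight0 D_skew ax byy).
Qed.

(** Two weight vectors that are not orthogonal have opposite weights, one of
    which is positive. *)
Lemma exists_hyperbolic_pair (X : seq g) :
  (forall v, v \in X -> exists a, weight D a v) ->
  (forall x y, x \in X -> y \in X -> B x y = 0) \/
  exists a e f, [/\ pos a, weight D a e, weight D (- a) f,
    e \in <<X>>%VS /\ f \in <<X>>%VS & B e f = 1].
Proof.
move=> wX; have [/allP X0 | /allPn[x xX /allPn[y yX Bxy]]] :=
  boolP (all (fun x => all (fun y => B x y == 0) X) X).
  by left=> x y xX yX; apply/eqP; move/allP: (X0 x xX); apply.
right; have [[a ax] [b b_y]] := (wX x xX, wX y yX).
have b_eq := form_weight_eq ax b_y Bxy; rewrite {}b_eq in b_y.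
have a0 : a != 0.
  apply: contraNneq Bxy => a0; rewrite a0 in ax.
  by rewrite (weight0_eq0 ax) herm0l.
have [xS yS] := (memv_span xX, memv_span yX).
case/orP: (pos_total a0) => pa.
  exists a, x, ((B x y)^-1 *: y); split=> //; first exact: weightZ.
    by split; rewrite // memvZ.
  by rewrite hermZr mulVf.
exists (- a), y, ((B x y)^-1 *: x); rewrite opprK; split=> //.
- exact: weightZ.
- by split; rewrite // memvZ.
by rewrite hermZr symC mulVf.
Qed.

(** An element (a, (e, f)) of H is a hyperbolic pair of weights a and - a. The
    proof splits off one such pair and goes on with the projections of X to its
    orthogonal. These are still weight vectors: the correction by a multiple of
    e, or of f, is zero unless its weight is that of the vector projected. *)
Lemma exists_hyperbolic_seq (X : seq g) :
  (forall v, v \in X -> exists a, weight D a v) ->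
  exists H : seq (K * (g * g)),
  [/\ uniq H,
    forall h, h \in H -> [/\ pos h.1, weight D h.1 h.2.1, weight D (- h.1) h.2.2
      & h.2.1 \in <<X>>%VS /\ h.2.2 \in <<X>>%VS],
    forall h k, h \in H -> k \in H -> B h.2.1 k.2.2 = (h == k)%:R &
    forall x y, x \in X -> y \in X -> B x y =
      \sum_(h <- H) (B x h.2.1 * B y h.2.2 + B x h.2.2 * B y h.2.1)].
Proof.
have [N] := ubnP (\dim <<X>>); elim: N X => // N IHN X dimX wX.
have [X0 | [a [e [f [pa ae af [eX fX] ef1]]]]] := exists_hyperbolic_pair wX.
  by exists [::]; split=> // x y xX yX; rewrite big_nil X0.
have aa0 : a + a != 0 by rewrite pos_neq0 ?posD.
have ee0 : B e e = 0 by apply: (form_weight0 D_skew ae ae).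
have ff0 : B f f = 0.
  by apply: (form_weight0 D_skew af af); rewrite -opprD oppr_eq0.
pose pr z := z - B z f *: e - B z e *: f.
have pr_f z : B (pr z) f = 0.
  by rewrite !hermBl !hermZl ef1 ff0 mulr1 mulr0 subrr subr0.
have pr_e z : B (pr z) e = 0.
  by rewrite !hermBl !hermZl ee0 (symC B f) ef1 mulr1 mulr0 subr0 subrr.
have pr_w v : v \in map pr X -> exists b, weight D b v.
  case/mapP=> z /wX[b bz] ->; exists b.
  apply: weightB; first apply: weightB => //.
    have [-> | zf] := eqVneq (B z f) 0.
      by rewrite scale0r; apply: weight0.
    apply: weightZ; have := form_weight_eq bz af zf.
    by move/eqP; rewrite eqr_opp => /eqP <-.
  have [-> | ze] := eqVneq (B z e) 0; first by rewrite scale0r; apply: weight0.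
  by apply: weightZ; have := form_weight_eq ae bz; rewrite symC => /(_ ze) ->.
have prX : (<<map pr X>> <= <<X>>)%VS.
  apply/span_subvP => _ /mapP[z zX ->].
  by rewrite !rpredB ?rpredZ // memv_span.
have pr_orth u : u \in <<map pr X>>%VS -> B u e = 0 /\ B u f = 0.
  apply: (span_closed (P := fun u => B u e = 0 /\ B u f = 0)) u.
  - by rewrite !herm0l.
  - move=> c x y [xe xf] [ye yf].
    by rewrite !hermDl !hermZl xe xf ye yf mulr0 addr0.
  by move=> _ /mapP[z _ ->].
have e_notin : e \notin <<map pr X>>%VS.
  by apply/negP => /pr_orth[_ /eqP]; rewrite ef1 oner_eq0.
have dim_pr : (\dim <<map pr X>> < N)%N.
  rewrite -ltnS (leq_trans _ dimX) // ltnS ltn_neqAle dimvS // andbT.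
  apply: contraNneq e_notin => dim_eq.
  by rewrite (eqP (_ : <<map pr X>> == <<X>>)%VS) // eqEdim prX dim_eq leqnn.
have [H [uH wH gramH compH]] := IHN _ dim_pr pr_w.
exists ((a, (e, f)) :: H); split.
- by rewrite /= uH andbT; apply: contra e_notin => /wH[_ _ _ []].
- move=> h; rewrite inE => /orP[/eqP-> // | /wH[? ? ? [he hf]]].
  by split=> //; split; apply: (subvP prX).
- have notH h : h \in H -> ((a, (e, f)) == h) = false.
    move=> hH; apply: contraNF e_notin => /eqP E.
    by case: (wH _ hH) => _ _ _ []; rewrite -E.
  move=> h k; rewrite !inE => /orP[/eqP-> | hH] /orP[/eqP-> | kH].
  + by rewrite eqxx.
  + by rewrite notH //= symC; case: (wH _ kH) => _ _ _ [_ /pr_orth[]].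
  + by rewrite eq_sym notH //=; case: (wH _ hH) => _ _ _ [/pr_orth[]].
  + exact: gramH.
move=> x y xX yX; rewrite big_cons /=.
have prE z h : h \in H ->
    B (pr z) h.2.1 = B z h.2.1 /\ B (pr z) h.2.2 = B z h.2.2.
  case/wH=> _ _ _ [/pr_orth[e1 f1] /pr_orth[e2 f2]].
  rewrite !hermBl !hermZl ![B e _]symC ![B f _]symC e1 e2 f1 f2.
  by rewrite !mulr0 !subr0.
have -> : \sum_(h <- H) (B x h.2.1 * B y h.2.2 + B x h.2.2 * B y h.2.1)
    = B (pr x) (pr y).
  rewrite compH ?map_f // big_seq [RHS]big_seq; apply: eq_bigr => h hH.
  by have [[-> ->] [-> ->]] := (prE x h hH, prE y h hH).
rewrite {2}/pr !hermBr !hermZr pr_e pr_f !mulr0 !subr0.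
by rewrite /pr !hermBl !hermZl (symC B e y) (symC B f y); ring.
Qed.
End Hyperbolic.

Lemma hyperbolic_dim (K : fieldType) (g : lieAlgType K) (B : {symmetric g}) n
    (e f : 'I_n -> g) :
  nondegenerate B -> hyperbolic B e f ->
  (forall i j, B (e i) (e j) = 0) -> (forall i j, B (f i) (f j) = 0) ->
  (forall i j, B (e i) (f j) = (i == j)%:R) -> \dim {:g} = n.*2.
Proof.
move=> B_nd ef_c ee ff ef.
pose co x : 'rV[K]_n * 'rV[K]_n := (\row_i B x (f i), \row_i B x (e i)).
have co_lin : linear co.
  by move=> c x y; congr (_, _); apply/rowP => i; rewrite !mxE hermDl hermZl.
pose F : 'Hom(g, ('rV[K]_n * 'rV[K]_n)%type) :=
  linfun (HB.pack co (GRing.isLinear.Build K g _ _ co co_lin)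
            : {linear g -> ('rV[K]_n * 'rV[K]_n)%type}).
have FE x : F x = co x by rewrite lfunE.
have F_inj : lker F == 0%VS.
  apply/lker0P => x y; rewrite !FE => -[/rowP xf /rowP xe].
  apply: (herm_ext B_nd) => z; rewrite !ef_c; apply: eq_bigr => i _.
  by move: (xf i) (xe i); rewrite !mxE => -> ->.
have F_surj : limg F = fullv.
  apply/eqP; rewrite eqEsubv subvf; apply/subvP => -[p q] _.
  have -> : (p, q) = F (\sum_i (p 0 i *: e i + q 0 i *: f i)).
    rewrite FE; congr (_, _); apply/rowP => j;
      rewrite mxE herm_suml (bigD1 j) //=.
      rewrite big1 ?addr0 => [|i ij]; rewrite hermDl !hermZl ff ef ?eqxx.
        by rewrite mulr1 mulr0 addr0.
      by rewrite (negPf ij) !mulr0 addr0.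
    rewrite big1 ?addr0 => [|i ij];
      rewrite hermDl !hermZl ee [B (f _) _]symC ef.
      by rewrite eqxx mulr1 mulr0 add0r.
    by rewrite eq_sym (negPf ij) !mulr0 addr0.
  exact/memv_img/memvf.
have := limg_dim_eq (f := F) (U := fullv); rewrite (eqP F_inj) capv0 => <- //.
by rewrite F_surj dimvf; change (1 * n + 1 * n = n.*2)%N; rewrite mul1n addnn.
Qed.

(** The triangularity is where the order comes in: a constant that is not zero
    forces a_i + a_j = a_k with a_i and a_j positive, so that k comes after i
    and j when the weights are sorted. *)
Lemma exists_bialgebra_frame (K : numClosedFieldType) (g : lieAlgType K)
    (B : {symmetric g}) (w : {skew_symmetric g}) :
  quadratic B -> symplectic w ->
  exists n, exists e f : 'I_n -> g, bialgebra_frame B e f /\ \dim {:g} = n.*2.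
Proof.
move=> B_quad w_symp.
have [D [D_inj D_skew D_der]] := exists_skew_derivation B_quad w_symp.
have [X wX X_full] := weight_basis D.
have [H0 [uniq_H0 wH0 gram0 comp0]] := exists_hyperbolic_seq D_inj D_skew wX.
pose le_h (h k : K * (g * g)) := pos_le h.1 k.1.
pose H := sort le_h H0.
have mem_H h : (h \in H) = (h \in H0) by rewrite mem_sort.
pose n := size H; pose h_ (i : 'I_n) := tnth (in_tuple H) i.
have h_in i : h_ i \in H0 by rewrite -mem_H mem_tnth.
have h_inj i j : (h_ i == h_ j) = (i == j).
  apply/eqP/eqP => [|-> //]; rewrite /h_ !(tnth_nth (0, (0, 0))) /= => /eqP.
  by rewrite nth_uniq ?sort_uniq // => /eqP/val_inj.
have h_sorted (i j : 'I_n) : (i <= j)%N -> pos_le (h_ i).1 (h_ j).1.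
  move=> le_ij; rewrite /h_ !(tnth_nth (0, (0, 0))) /=.
  apply: (sorted_leq_nth (leT := le_h)) => //.
  - by move=> h1 h2 h3; apply: pos_le_trans.
  - by move=> h1; rewrite /le_h /pos_le eqxx.
  - by apply: sort_sorted => h1 h2; apply: pos_le_total.
  - exact: ltn_ord.
  - exact: ltn_ord.
pose e (i : 'I_n) := (h_ i).2.1; pose f (i : 'I_n) := (h_ i).2.2.
pose a (i : 'I_n) := (h_ i).1.
have a_pos i : pos (a i) by case: (wH0 _ (h_in i)).
have a_e i : weight D (a i) (e i) by case: (wH0 _ (h_in i)).
have a_f i : weight D (- a i) (f i) by case: (wH0 _ (h_in i)).
have ee i j : B (e i) (e j) = 0.
  by apply: (form_weight0 D_skew (a_e i) (a_e j)); rewrite pos_neq0 ?posD.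
have ff i j : B (f i) (f j) = 0.
  apply: (form_weight0 D_skew (a_f i) (a_f j)).
  by rewrite -opprD oppr_eq0 pos_neq0 ?posD.
have ef i j : B (e i) (f j) = (i == j)%:R by rewrite gram0 ?h_in // h_inj.
have ef_c : hyperbolic B e f.
  suff comp x y : B x y =
      \sum_(h <- H0) (B x h.2.1 * B y h.2.2 + B x h.2.2 * B y h.2.1).
    move=> x y; rewrite comp -(perm_big _ (permEl (perm_sort le_h H0))) /=.
    by rewrite -/H big_tnth.
  have [xX yX] : x \in <<X>>%VS /\ y \in <<X>>%VS by rewrite X_full !memvf.
  move: x xX; apply: span_closed.
  - by rewrite herm0l big1 // => h _; rewrite !herm0l !mul0r addr0.
  - move=> c x1 x2 IH1 IH2; rewrite hermDl hermZl IH1 IH2 mulr_sumr -big_split.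
    by apply: eq_bigr => h _ /=; rewrite !hermDl !hermZl; ring.
  move=> x xX; move: y yX; apply: span_closed.
  - by rewrite herm0r big1 // => h _; rewrite !herm0l !mulr0 addr0.
  - move=> c y1 y2 IH1 IH2; rewrite hermDr hermZr IH1 IH2 mulr_sumr -big_split.
    by apply: eq_bigr => h _ /=; rewrite !hermDl !hermZl; ring.
  by move=> y yX; apply: comp0.
have tri (i j k : 'I_n) : a i + a j = a k -> (i < k)%N.
  move=> aij; rewrite ltnNge; apply/negP => /h_sorted; rewrite -/(a k) -/(a i).
  rewrite -aij /pos_le opprD addNKr (negPf (pos_asym (a_pos j))) orbF.
  by rewrite -subr_eq0 addrAC subrr add0r (negPf (pos_neq0 (a_pos j))).
exists n, e, f; split; last by apply: (hyperbolic_dim (proj1 B_quad) ef_c).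
split=> //.
- move=> i j k; apply: (triple_weight0 D_der (a_e i) (a_e j) (a_e k)).
  by rewrite pos_neq0 ?posD.
- move=> i j k; apply: (triple_weight0 D_der (a_f i) (a_f j) (a_f k)).
  by rewrite -!opprD oppr_eq0 pos_neq0 ?posD.
- move=> i j k; rewrite /structure_const => c_neq0.
  have /eqP : a i + a j + - a k = 0.
    apply: contraNeq c_neq0 => s0; apply/eqP.
    exact: (triple_weight0 D_der (a_e i) (a_e j) (a_f k)).
  rewrite subr_eq0 => /eqP aij; rewrite (tri i j k aij) (tri j i k) //.
  by rewrite addrC.
move=> i j k; rewrite /structure_const => c_neq0.
have /eqP : - a i + - a j + a k = 0.
  apply: contraNeq c_neq0 => s0; apply/eqP.
  exact: (triple_weight0 D_der (a_f i) (a_f j) (a_e k)).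
rewrite -opprD addrC subr_eq0 => /eqP aij.
by rewrite (tri i j k) // (tri j i k) // addrC.
Qed.

(** * The classification *)

Theorem theorem3p3 (R : realType) (g : lieAlgType R[i]) (B : {symmetric g})
    (B_quadratic : quadratic B)
    (g_symplectic : exists w : {skew_symmetric g}, symplectic w)
    (g_neq0 : {:g}%VS != 0%VS) (dim_g : (\dim {:g} <= 8)%N) :
  [\/ exists2 n, (1 <= n <= 4)%N &
        isometrically_isomorphic B (Tstar_form (abelian_lie R[i] n)),
      isometrically_isomorphic B (Tstar_form (heisenberg R[i])),
      isometrically_isomorphic B
        (Tstar_form (heisenberg R[i] * abelian_lie R[i] 1)%type) |
      isometrically_isomorphic B (Tstar_form (filiform R[i]))].
Proof.
have [w w_symp] := g_symplectic.
have [n [e [f [ef dimE]]]] := exists_bialgebra_frame B_quadratic w_symp.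
rewrite dimE (leq_double n 4) in dim_g.
have n_gt0 : (0 < n)%N by rewrite -double_gt0 -dimE lt0n dimv_eq0.
have [n_le2 | n_gt2] := leqP n 2.
  by apply: (frame_le2_classified B_quadratic ef dimE); rewrite n_gt0.
case: n => [|[|[|[|[|n]]]]] // in e f ef dimE dim_g n_gt0 n_gt2 *.
  exact: (frame3_classified B_quadratic ef dimE).
apply: (frame4_classified B_quadratic _ ef dimE).
by rewrite pnatr_eq0.
Qed.
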